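(* Let $T_2,T_3\in \mathcal{L}_A(\mathcal{H})$. Then $$w_{\mathbb{A}}\left(\begin{bmatrix} 0 & T_2\\ T_3 & 0\end{bmatrix}\right)\leq \min\left\{w_A(T_2), w_A(T_3)\right\}+\min\left\{\frac{\|T_2+T_3\|_A}{2}, \frac{\|T_2-T_3\|_A}{2}\right\}.$$
   Context: $\mathcal{H}$ is a complex Hilbert space with inner product $\langle\cdot,\cdot\rangle$, and $\mathcal{L}(\mathcal{H})$ is the algebra of bounded linear operators on $\mathcal{H}$. $A\in\mathcal{L}(\mathcal{H})$ is a fixed positive operator, i.e. $A=A^*$ and $\langle Ax,x\rangle\ge 0$ for all $x\in\mathcal{H}$ ($A$ need not be injective). Put $\langle x,y\rangle_A=\langle Ax,y\rangle$ and $\|x\|_A=\sqrt{\langle x,x\rangle_A}$ (a seminorm). $\mathcal{R}(\cdot)$ denotes the range, and $\mathcal{L}_A(\mathcal{H})=\{T\in\mathcal{L}(\mathcal{H}):\mathcal{R}(T^*A)\subseteq\mathcal{R}(A)\}$ (the operators admitting an $A$-adjoint, i.e. an $X\in\mathcal{L}(\mathcal{H})$ with $AX=T^*A$). For $T\in\mathcal{L}_A(\mathcal{H})$ the $A$-operator seminorm is $\|T\|_A=\sup\{\|Tx\|_A/\|x\|_A : x\in\overline{\mathcal{R}(A)},\ x\ne 0\}$, and the $A$-numerical radius is $w_A(T)=\sup\{|\langle Tx,x\rangle_A| : x\in\mathcal{H},\ \|x\|_A=1\}$. $\mathbb{A}=\begin{bmatrix} A&0\\0&A\end{bmatrix}$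 is the positive diagonal operator on $\mathcal{H}\oplus\mathcal{H}$, and $w_{\mathbb{A}}$ is the numerical radius defined in the same way with $(\mathcal{H}\oplus\mathcal{H},\mathbb{A})$ in place of $(\mathcal{H},A)$. *)

(* Defs.v *)
From HB Require Import structures.
From mathcomp Require Import all_boot all_order all_algebra.
From mathcomp Require Import all_classical all_reals.
From mathcomp Require Import topology ereal normedtype complex.

Set Implicit Arguments.
Unset Strict Implicit.
Unset Printing Implicit Defensive.

Import Order.TTheory GRing.Theory Num.Theory.
Import numFieldNormedType.Exports.

Local Open Scope classical_set_scope.
Local Open Scope complex_scope.
Local Open Scope ring_scope.

(* The supremum in [0, +oo] of a set of nonnegative reals: it is 0 when S is
   empty, which happens below only if A = 0. *)
Definition sup_ge0 (R : realType) (S : set R) : \bar R :=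
  maxe 0%E (ereal_sup [set r%:E | r in S]).

Section hilbert.
Variables (R : realType) (H : completeNormedModType R[i]).

(* A complex Hilbert space is a Banach space H over R[i] whose norm comes from
   an inner product, which sesquilinear.v takes linear in its left argument. *)
Definition hilbert_dot (dot : {dot H for Num.conj}) : Prop :=
  forall x : H, `|x| ^+ 2 = dot x x.

Definition bounded_op (T : {linear H -> H}) : Prop :=
  exists M : R[i], forall x, `|T x| <= M * `|x|.

Variable dot : {dot H for Num.conj}.

(* S = T^* *)
Definition is_adjoint (T S : {linear H -> H}) : Prop :=
  bounded_op S /\ forall x y, dot (T x) y = dot x (S y).

(* In R[i], 0 <= z means that z is real and nonnegative. *)
Definition positive_op (A : {linear H -> H}) : Prop :=
  [/\ bounded_op A, is_adjoint A A & forall x, 0 <= dot (A x) x].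

(* T \in L_A(H); the adjoint of a bounded operator exists and is unique. *)
Definition has_A_adjoint (A T : {linear H -> H}) : Prop :=
  bounded_op T /\
  exists2 Tstar : {linear H -> H}, is_adjoint T Tstar &
    range (Tstar \o A) `<=` range A.

End hilbert.

(* These notions do not involve the topology of V, so that they also apply to
   H * H, whose library norm is the max norm. *)
Section semi_inner_product.
Variables (R : realType) (V : lmodType R[i]) (dot : {dot V for Num.conj}).
Variable A : V -> V.

Definition A_dot (x y : V) : R[i] := dot (A x) y.

Definition A_norm (x : V) : R := Num.sqrt (complex.Re (A_dot x x)).

Definition A_numerical_radius (T : V -> V) : \bar R :=
  sup_ge0 [set complex.Re `|A_dot (T x) x| | x in [set x | A_norm x = 1]].

End semi_inner_product.

Definition A_opnorm (R : realType) (H : completeNormedModType R[i])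
    (dot : {dot H for Num.conj}) (A T : H -> H) : \bar R :=
  sup_ge0 [set A_norm dot A (T x) / A_norm dot A x |
           x in [set x | closure (range A) x /\ x != 0]].

Section direct_sum.
Variables (R : realType) (V : lmodType R[i]) (dot : {dot V for Num.conj}).

Definition dsum_dot (u v : V * V) : R[i] := dot u.1 v.1 + dot u.2 v.2.

Fact dsum_dot_bilinear :
  bilinear_for ( *%R : R[i] -> R[i] -> R[i]) (Num.conj \; *%R) dsum_dot.
Proof.
split=> [u' a u v | u a v w] /=; rewrite /dsum_dot /=.
  by rewrite !linearPl /= mulrDr addrACA.
by rewrite !linearPr /= mulrDr addrACA.
Qed.

HB.instance Definition _ := bilinear_isBilinear.Build R[i] (V * V)%type
  (V * V)%type R[i] _ _ dsum_dot dsum_dot_bilinear.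

Fact dsum_dot_hermitian (u v : V * V) :
  dsum_dot u v = (-1) ^+ false * Num.conj (dsum_dot v u).
Proof.
rewrite /dsum_dot rmorphD mulrDr.
by congr (_ + _); apply: hermitian_subproof.
Qed.

HB.instance Definition _ := isHermitianSesquilinear.Build R[i] (V * V)%type
  false Num.conj dsum_dot dsum_dot_hermitian.

Fact dsum_dot_gt0 (u : V * V) : u != 0 -> 0 < dsum_dot u u.
Proof.
have ge0 x : 0 <= dot x x.
  by have [->|/neq0_dnorm_gt0/ltW//] := eqVneq x 0; rewrite linear0l.
case: u => x y; rewrite /dsum_dot /= => xy0.
have [x0|/neq0_dnorm_gt0 x0] := eqVneq x 0; last exact: ltr_wpDr.
have [y0|/neq0_dnorm_gt0 y0] := eqVneq y 0; last exact: ltr_wpDl.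
by rewrite x0 y0 eqxx in xy0.
Qed.

HB.instance Definition _ := isDotProduct.Build R[i] (V * V)%type
  dsum_dot dsum_dot_gt0.

(* The operator on V (+) V with matrix [T11, T12; T21, T22]. *)
Definition block_op (T11 T12 T21 T22 : V -> V) (u : V * V) : V * V :=
  (T11 u.1 + T12 u.2, T21 u.1 + T22 u.2).

End direct_sum.

(* Main.v *)
(* Polarization bounds <T y, x>_A + <T x, y>_A, and likewise the difference, by
   w_A(T) (|x|_A^2 + |y|_A^2); writing T3 = T2 - (T2 - T3) or
   T3 = -T2 + (T2 + T3) leaves <(T2 -+ T3) x, y>_A, which Cauchy-Schwarz bounds
   by the A-operator seminorm. As that seminorm is a supremum over the closure
   of the range of A only, one needs that x splits as z + k with z in this
   closure and A k = 0, and that operators with an A-adjoint preserve ker A. *)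
Require Import Defs.
From HB Require Import structures.
From mathcomp Require Import all_boot all_order all_algebra.
From mathcomp Require Import all_classical all_reals.
From mathcomp Require Import topology ereal normedtype complex.
From mathcomp Require Import ring lra.
Import Order.TTheory GRing.Theory Num.Theory.
Import numFieldNormedType.Exports.
Local Open Scope classical_set_scope.
Local Open Scope complex_scope.
Local Open Scope ring_scope.

Set Implicit Arguments.
Unset Strict Implicit.

(** * Suprema in [0, +oo] *)

Section sup_ge0.
Variables (R : realType) (S : set R).
Local Open Scope ereal_scope.

Lemma sup_ge0_ge0 : 0 <= sup_ge0 S.
Proof. by rewrite /sup_ge0 le_max lexx. Qed.

Lemma sup_ge0_ub (r : R) : S r -> r%:E <= sup_ge0 S.
Proof.
move=> Sr; rewrite /sup_ge0 le_max; apply/orP; right.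
by apply: ereal_sup_ubound; exists r.
Qed.

Lemma sup_ge0_le (M : \bar R) :
  0 <= M -> (forall r, S r -> r%:E <= M) -> sup_ge0 S <= M.
Proof.
move=> M0 SM; rewrite /sup_ge0 ge_max M0 /=.
by apply: ge_ereal_sup => _ [r Sr <-]; apply: SM.
Qed.

End sup_ge0.

(** * Semi-inner products and their seminorms *)

Section semi_inner.
Variables (R : realType) (V : lmodType R[i]) (B : V -> V -> R[i]).

(** An abstract form [B] covers both [dot] and the possibly degenerate [A_dot dot A], whose
    [seminorm] is convertible to [A_norm dot A]. *)
Definition semi_inner_product :=
  [/\ forall a u v w, B (a *: u + v) w = a * B u w + B v w,
      forall u v, B u v = (B v u)^* & forall u, 0 <= B u u].

Definition seminorm (u : V) : R := Num.sqrt (complex.Re (B u u)).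

Hypothesis hB : semi_inner_product.

Let BPl := let: And3 h _ _ := hB in h.
Let BC := let: And3 _ h _ := hB in h.
Let B_ge0 := let: And3 _ _ h := hB in h.

Lemma semi_innerZl a u v : B (a *: u) v = a * B u v.
Proof.
have B0 : B 0 v = 0.
  by have := BPl (-1) 0 0 v; rewrite scaler0 addr0 mulN1r addNr.
by have := BPl a u 0 v; rewrite addr0 B0 addr0.
Qed.

Lemma semi_innerDl u v w : B (u + v) w = B u w + B v w.
Proof. by have := BPl 1 u v w; rewrite scale1r mul1r. Qed.

Lemma semi_innerZr a u v : B u (a *: v) = a^* * B u v.
Proof. by rewrite BC semi_innerZl rmorphM /= -BC. Qed.

Lemma semi_innerDr u v w : B u (v + w) = B u v + B u w.
Proof. by rewrite BC semi_innerDl rmorphD /= -!BC. Qed.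

Lemma semi_innerBl u v w : B (u - v) w = B u w - B v w.
Proof. by rewrite semi_innerDl -scaleN1r semi_innerZl mulN1r. Qed.

Lemma semi_innerBr u v w : B u (v - w) = B u v - B u w.
Proof. by rewrite BC semi_innerBl rmorphB /= -!BC. Qed.

Lemma seminorm_ge0 u : 0 <= seminorm u.
Proof. exact: sqrtr_ge0. Qed.

Lemma seminorm0 : seminorm 0 = 0.
Proof. by rewrite /seminorm -(scale0r 0) semi_innerZl mul0r sqrtr0. Qed.

(** Nonnegativity in [R[i]] includes being real, so the real part taken in [seminorm] loses
    nothing. *)
Lemma sqr_seminorm u : (seminorm u ^+ 2)%:C = B u u.
Proof.
have := B_ge0 u; rewrite lecE /= => /andP[/eqP Im0 Re0].
by rewrite sqr_sqrtr //; apply/eqP; rewrite eq_complex /= Im0 !eqxx.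
Qed.

Lemma seminorm_parallelogram u v :
  seminorm (u + v) ^+ 2 + seminorm (u - v) ^+ 2 =
  2 * (seminorm u ^+ 2 + seminorm v ^+ 2).
Proof.
apply: complexI; rewrite rmorphD [RHS]rmorphM rmorph_nat rmorphD /= !sqr_seminorm.
rewrite semi_innerDl semi_innerBl !semi_innerBr !semi_innerDr.
by ring.
Qed.

Lemma seminormZ a u : (seminorm (a *: u) ^+ 2)%:C = `|a| ^+ 2 * B u u.
Proof.
by rewrite sqr_seminorm semi_innerZl semi_innerZr mulrA sqr_normc.
Qed.

(* With [d = 0] this is the orthogonality of a minimizer, and with
   [d = seminorm e] the hypothesis is void and this is Cauchy-Schwarz. *)
Lemma near_minimizer_orthogonal (d : R) e w : 0 <= d ->
  (forall c, seminorm e ^+ 2 <= seminorm (e - c *: w) ^+ 2 + d ^+ 2) ->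
  `|B e w| <= (d * seminorm w)%:C.
Proof.
move=> d0 emin.
have [b b0 bE] : exists2 b : R, 0 <= b & `|B e w| = b%:C.
  by rewrite normc_def; eexists; last reflexivity; apply: sqrtr_ge0.
(* Testing [emin] at c = s B(e, w) with s real makes the cross terms real: together they are -2 s
   b^2. *)
have key (s : R) : 2 * s * b ^+ 2 <= s ^+ 2 * b ^+ 2 * seminorm w ^+ 2 + d ^+ 2.
  have := emin (s%:C * B e w).
  suff -> : seminorm (e - (s%:C * B e w) *: w) ^+ 2 =
    seminorm e ^+ 2 - 2 * s * b ^+ 2 + s ^+ 2 * b ^+ 2 * seminorm w ^+ 2 by lra.
  have b2 : (b ^+ 2)%:C = B e w * (B e w)^* by rewrite rmorphXn /= -bE sqr_normc.
  have rcE (x y z t : R) : (x - 2 * s * y + z * y * t)%:C =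
      x%:C - 2 * s%:C * y%:C + z%:C * y%:C * t%:C.
    by rewrite rmorphD rmorphB !rmorphM rmorph_nat /=.
  apply: complexI; rewrite rcE !sqr_seminorm b2 rmorphXn /=.
  rewrite semi_innerBl !semi_innerBr !semi_innerZl !semi_innerZr rmorphM /=.
  have -> : (s%:C)^* = s%:C := conjc_real s.
  rewrite [B w e]BC; ring.
rewrite bE lecR -(@ler_sqr _ b) ?nnegrE ?mulr_ge0 ?seminorm_ge0 // exprMn.
(* If w has seminorm 0, [key] bounds 2 s b^2 by d^2 for every s, which forces b = 0. Otherwise s = 1
   / (seminorm w)^2 is the optimal choice. *)
have [w0|w0] := eqVneq (seminorm w) 0.
  rewrite w0 expr0n /= mulr0 in key *.
  have [->|bn0] := eqVneq b 0; first by rewrite expr0n.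
  have := key ((d ^+ 2 + 1) / b ^+ 2); rewrite mulr0 add0r.
  rewrite -!mulrA mulVf ?expf_neq0 // => h; have := sqr_ge0 d; lra.
have := key (seminorm w ^- 2).
have W0 : 0 < seminorm w ^+ 2 by rewrite exprn_gt0 // lt_def w0 seminorm_ge0.
set W := seminorm w ^+ 2 in W0 *.
have -> : W^-1 ^+ 2 * b ^+ 2 * W = W^-1 * b ^+ 2 by field; rewrite gt_eqF.
move=> h; have : W^-1 * b ^+ 2 <= d ^+ 2 by lra.
by rewrite mulrC ler_pdivrMr.
Qed.

Lemma semi_inner_CauchySchwarz u v : `|B u v| <= (seminorm u * seminorm v)%:C.
Proof.
apply: near_minimizer_orthogonal (seminorm_ge0 u) _ => c.
by rewrite lerDr sqr_ge0.
Qed.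

End semi_inner.

(** * Projection onto the closure of a subspace *)

Section projection.
Variables (R : realType) (H : completeNormedModType R[i]).
Variables (dot : {dot H for Num.conj}) (dotH : hilbert_dot dot).

Lemma dot_semi_inner : semi_inner_product dot.
Proof.
split=> [a u v w|u v|u]; first by rewrite linearPl.
- by rewrite hermC expr0 mul1r.
- exact: dnorm_ge0.
Qed.

Lemma seminorm_dot (x : H) : (seminorm dot x)%:C = `|x|.
Proof.
apply/eqP; rewrite -(@eqrXn2 _ 2) ?normr_ge0 ?ler0c ?seminorm_ge0 //.
by rewrite dotH -(sqr_seminorm dot_semi_inner) rmorphXn.
Qed.

(* The near-minimizers of the distance from x to W generate a filter, which is
   Cauchy by the parallelogram law; z is its limit. *)
Lemma closure_projection (W : set H) (x : H) : W 0 ->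
  (forall a u v, W u -> W v -> W (a *: u + v)) ->
  exists2 z, closure W z & forall w, W w -> dot (x - z) w = 0.
Proof.
move=> W0 WP; pose p := seminorm dot; pose D := inf [set p (x - w) ^+ 2 | w in W].
have hB := dot_semi_inner.
have D_has_inf : has_inf [set p (x - w) ^+ 2 | w in W].
  split; first by exists (p (x - 0) ^+ 2), 0.
  by exists 0 => _ [w _ <-]; apply: sqr_ge0.
have D_le w : W w -> D <= p (x - w) ^+ 2.
  by move=> Ww; apply: ge_inf; [exact: D_has_inf.2|exists w].
pose near_min (e : R) := [set w | W w /\ p (x - w) ^+ 2 <= D + e ^+ 2].
have near_min_dist e w1 w2 : 0 < e -> near_min e w1 -> near_min e w2 ->
    p (w1 - w2) <= 2 * e.
  move=> e0 [W1 h1] [W2 h2].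
  (* The midpoint of w1 and w2 lies in W, so its squared distance to x is at least D; the
     parallelogram law then gives p (w1 - w2)^2 <= 4 (D + e^2) - 4 D. *)
  have Wmid : W (2^-1 *: (w1 + w2)).
    rewrite -[_ *: _]addr0; apply: (WP) => //.
    by rewrite -[w1]scale1r; apply: (WP).
  have dmid : p ((x - w2) + (x - w1)) ^+ 2 = 4 * p (x - 2^-1 *: (w1 + w2)) ^+ 2.
    have -> : (x - w2) + (x - w1) = 2%:R *: (x - 2^-1 *: (w1 + w2)).
      rewrite scalerBr scalerA divff ?pnatr_eq0 // scale1r scaler_nat mulr2n.
      by rewrite opprD addrACA [- w2 + _]addrC.
    apply: complexI; rewrite /p (seminormZ hB) rmorphM /= rmorph_nat.
    by rewrite (sqr_seminorm hB) normr_nat -natrX.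
  have dsub : (x - w2) - (x - w1) = w1 - w2.
    by rewrite opprB addrC addrA subrK.
  rewrite -(@ler_sqr _ (p _)) ?nnegrE ?seminorm_ge0 ?mulr_ge0 ?(ltW e0) // exprMn.
  have := seminorm_parallelogram hB (x - w2) (x - w1).
  rewrite -/p dmid dsub; have := D_le _ Wmid; lra.
have near_min_ex e : 0 < e -> exists w, near_min e w.
  move=> e0; have [_ [w Ww <-] /ltW h] := inf_adherent (exprn_gt0 2 e0) D_has_inf.
  by exists w.
pose F := filter_from [set e : R | 0 < e] near_min.
have FF : ProperFilter F.
  apply: filter_from_proper; last exact: near_min_ex.
  apply: filter_from_filter; first by exists 1 => /=.
  move=> e1 e2 /= e10 e20; exists (Num.min e1 e2); first by rewrite /= lt_min e10.
  have m0 : 0 <= Num.min e1 e2 by rewrite le_min !ltW.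
  move=> w [Ww hw]; split; split=> //; apply: (le_trans hw); rewrite lerD2l.
    by rewrite ler_sqr ?nnegrE ?(ltW e10) // ge_min lexx.
  by rewrite ler_sqr ?nnegrE ?(ltW e20) // ge_min lexx orbT.
have ballE (u v : H) (e : R) : ball u e%:C v <-> p (u - v) < e.
  by rewrite -ball_normE /= -seminorm_dot ltcR.
have : cauchy F.
  apply: cauchy_exP => eps; rewrite ltcE /= => /andP[/eqP eI e0].
  have -> : eps = (complex.Re eps)%:C by apply/eqP; rewrite eq_complex /= eI !eqxx.
  set e := complex.Re eps in e0 *.
  (* Near-minimizers for e / 3 are at most 2 e / 3 < e apart, so all of them lie in the ball of
     radius e around any one. *)
  have e30 : 0 < e / 3 by rewrite divr_gt0.
  have [w hw] := near_min_ex _ e30.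
  exists w, (e / 3) => //= v hv; apply/ballE.
  by apply: le_lt_trans (near_min_dist _ _ _ e30 hw hv) _; lra.
move=> /cauchy_cvgP /cvg_ex[z Fz]; exists z.
  move=> N /Fz FN; have [|w [[Ww _] Nw]] := @filter_ex _ _ FF (near_min 1 `&` N).
    by apply: filterI => //; exists 1 => /=.
  by exists w.
move=> w Ww.
(* Replace z by a d-near-minimizer v within d of z: x - v is orthogonal to w up to d p(w), and
   Cauchy-Schwarz bounds the error from z - v by d p(w). *)
have small (d : R) : 0 < d -> `|dot (x - z) w| <= (d * (2 * p w))%:C.
  move=> d0.
  have Fd : F (ball z d%:C) by apply/Fz/nbhsx_ballx; rewrite ltcR.
  have [|v [[Wv hv] /ballE zv]] := @filter_ex _ _ FF (near_min d `&` ball z d%:C).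
    by apply: filterI => //; exists d.
  have -> : dot (x - z) w = dot (x - v) w - dot (z - v) w.
    by rewrite -(semi_innerBl hB) opprB addrA subrK.
  apply: le_trans (ler_normB _ _) _.
  have h1 : `|dot (x - v) w| <= (d * p w)%:C.
    apply: (near_minimizer_orthogonal hB); first exact: ltW.
    move=> c; apply: (le_trans hv); rewrite lerD2r -addrA -opprD; apply: D_le.
    by rewrite addrC; apply: (WP).
  have h2 : `|dot (z - v) w| <= (d * p w)%:C.
    apply: le_trans (semi_inner_CauchySchwarz hB _ _) _.
    by rewrite lecR ler_wpM2r ?seminorm_ge0 // ltW.
  apply: le_trans (lerD h1 h2) _.
  by rewrite -rmorphD lecR /=; lra.
apply/eqP; rewrite -normr_le0.
have [b bE] : exists b : R, `|dot (x - z) w| = b%:C.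
  by rewrite normc_def; eexists.
rewrite bE lecR; apply/ler_addgt0Pl => e e0; rewrite addr0.
(* The added 1 keeps the denominator positive when p w = 0. *)
have q0 : 0 < 2 * p w + 1 by have := seminorm_ge0 dot w; rewrite -/p; lra.
have := small (e / (2 * p w + 1)) (divr_gt0 e0 q0); rewrite bE lecR => h.
apply: (le_trans h); rewrite mulrAC ler_pdivrMr // ler_wpM2l ?ltW //; lra.
Qed.

End projection.

(** * Bounds by the A-operator seminorm and the A-numerical radius *)

Section A_seminorm.
Variables (R : realType) (H : completeNormedModType R[i]).
Variables (dot : {dot H for Num.conj}) (A : {linear H -> H}).
Hypothesis A_pos : positive_op dot A.

Local Notation B := (A_dot dot A).
Local Notation p := (A_norm dot A).

Lemma A_dot_semi_inner : semi_inner_product B.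
Proof.
case: A_pos => _ [_ AA] A0; split => // [a u v w|u v].
  by rewrite /A_dot linearP linearPl.
by rewrite /A_dot AA hermC expr0 mul1r.
Qed.

(** Cauchy-Schwarz for [B] on the pair u, A u bounds <A u, A u> by 0. *)
Lemma A_norm_eq0 u : p u = 0 -> A u = 0.
Proof.
move=> u0; apply/eqP; rewrite -(dnorm_eq0 dot) -normr_le0.
have := semi_inner_CauchySchwarz A_dot_semi_inner u (A u).
by rewrite -[seminorm _ u]/(p u) u0 mul0r.
Qed.

Lemma A_norm_addr_ker u k : A k = 0 -> p (u + k) = p u.
Proof.
move=> k0; have [_ [_ AA] _] := A_pos.
by rewrite /A_norm /A_dot linearD k0 addr0 linearDr /= (AA u k) k0 linear0r addr0.
Qed.

(** The range inclusion provides z with T^* A (A T u) = A z, so <A T u, A T u> = <u, A z> = <A u, z>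
    = 0. *)
Lemma has_A_adjoint_ker (T : {linear H -> H}) u :
  has_A_adjoint dot A T -> A u = 0 -> A (T u) = 0.
Proof.
move=> [_ [Ts [_ TTs] TsA]] u0; have [_ [_ AA] _] := A_pos.
have [|z _ zE] := TsA (Ts (A (A (T u)))); first by exists (A (T u)).
by apply/eqP; rewrite -(dnorm_eq0 dot) AA TTs -zE -AA u0 linear0l.
Qed.

Lemma le_A_opnorm (dotH : hilbert_dot dot) (S : {linear H -> H}) (C : R) x :
  (forall u, A u = 0 -> A (S u) = 0) -> A_opnorm dot A S = C%:E ->
  p (S x) <= C * p x.
Proof.
move=> S_ker SC; have [_ [_ AA] _] := A_pos.
have W0 : range A 0 by exists 0 => //; rewrite linear0.
have WP (a : R[i]) u v : range A u -> range A v -> range A (a *: u + v).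
  by move=> [u' _ <-] [v' _ <-]; exists (a *: u' + v') => //; rewrite linearP.
have [z clz zP] := closure_projection dotH x W0 WP.
(* As x - z is orthogonal to the range of the self-adjoint A, it lies in ker A; passing from x to z
   thus changes neither p x nor p (S x). *)
have Axz : A (x - z) = 0.
  by apply/eqP; rewrite -(dnorm_eq0 dot) AA zP.
have -> : p x = p z by rewrite -[x in LHS](subrK z) addrC A_norm_addr_ker.
have -> : p (S x) = p (S z).
  by rewrite -[x in LHS](subrK z) addrC linearD A_norm_addr_ker ?S_ker.
(* When p z = 0 the quotient in [A_opnorm] says nothing about p (S z), but then A z = 0 and [S_ker]
   gives p (S z) = 0. *)
have [z0|z0] := eqVneq (p z) 0.
  rewrite z0 mulr0.
  have ASz : A (S z) = 0 by apply: S_ker; apply: A_norm_eq0.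
  by rewrite -[S z]add0r A_norm_addr_ker // [p 0](seminorm0 A_dot_semi_inner).
rewrite -ler_pdivrMr; last by rewrite lt_def z0 sqrtr_ge0.
rewrite -lee_fin -SC; apply: sup_ge0_ub; exists z => //; split=> //.
apply: contra_neq z0 => ->.
exact: seminorm0 A_dot_semi_inner.
Qed.

Lemma le_A_numerical_radius (T : {linear H -> H}) (w : R) x :
  A_numerical_radius dot A T = w%:E -> `|B (T x) x| <= (w * p x ^+ 2)%:C.
Proof.
move=> Tw; have hB := A_dot_semi_inner.
(* A vector of seminorm 0 cannot be normalized; there Cauchy-Schwarz makes the left side 0. *)
have [x0|x0] := eqVneq (p x) 0.
  have := semi_inner_CauchySchwarz hB (T x) x.
  by rewrite -[seminorm _ x]/(p x) x0 mulr0 expr0n mulr0.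
have p0 : 0 < p x by rewrite lt_def x0 sqrtr_ge0.
set a := (p x)^-1%:C.
have aC : a^* = a := conjc_real _.
have pax : p (a *: x) = 1.
  apply/eqP; rewrite -(@eqrXn2 _ 2) ?sqrtr_ge0 ?expr1n //; apply/eqP.
  apply: complexI; rewrite (seminormZ hB) -(sqr_seminorm hB).
  rewrite -[seminorm _ x]/(p x) sqr_normc -[a^*%C]/(a^*) aC /a -!rmorphM /=.
  by congr (_%:C); field.
have [b bE] : exists b : R, `|B (T x) x| = b%:C.
  by rewrite normc_def; eexists.
have := @sup_ge0_ub R [set complex.Re `|B (T x) x| | x in [set x | p x = 1]]
  (complex.Re `|B (T (a *: x)) (a *: x)|).
rewrite -[sup_ge0 _]/(A_numerical_radius dot A T) Tw lee_fin => h.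
have {h}: complex.Re `|B (T (a *: x)) (a *: x)| <= w by apply: h; exists (a *: x).
rewrite linearZ (semi_innerZl hB) (semi_innerZr hB) aC mulrA normrM bE.
have -> : `|a * a| = (p x ^- 2)%:C.
  by rewrite ger0_norm -rmorphM ?ler0c ?mulr_ge0 ?invr_ge0 ?(ltW p0) // -invfM.
by rewrite -rmorphM /= mulrC ler_pdivrMr ?exprn_gt0 // lecR.
Qed.

(** With q(u) = <T u, u>_A, twice the form on the left is q(x + c y) - q(x - c y); the parallelogram
    law adds up the two bounds. *)
Lemma numerical_radius_polarization (T : {linear H -> H}) (w : R) (c : R[i]) x y :
  A_numerical_radius dot A T = w%:E -> `|c| = 1 ->
  `|c * B (T y) x + c^* * B (T x) y| <= (w * (p x ^+ 2 + p y ^+ 2))%:C.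
Proof.
move=> Tw c1; have hB := A_dot_semi_inner.
have pcy : p (c *: y) ^+ 2 = p y ^+ 2.
  apply: complexI.
  by rewrite (seminormZ hB) c1 expr1n mul1r (sqr_seminorm hB).
have E : 2 * (c * B (T y) x + c^* * B (T x) y) =
  B (T (x + c *: y)) (x + c *: y) - B (T (x - c *: y)) (x - c *: y).
  rewrite linearD linearB linearZ /= (semi_innerDl hB) (semi_innerBl hB).
  rewrite !(semi_innerBr hB) !(semi_innerDr hB) !(semi_innerZl hB).
  by rewrite !(semi_innerZr hB); ring.
have := seminorm_parallelogram hB x (c *: y).
rewrite -[seminorm _]/p pcy => par.
rewrite -(@ler_pM2l _ 2) // -{1}(normr_nat R[i] 2) -normrM E.
apply: le_trans (ler_normB _ _) _.
apply: le_trans (lerD (le_A_numerical_radius _ Tw) (le_A_numerical_radius _ Tw)) _.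
by rewrite -rmorphD /= -mulrDr par -(rmorph_nat (real_complex R)) -rmorphM /= lecR; lra.
Qed.

(* Polarization is used at c = 'i when s = true, and at c = 1 otherwise. *)
Lemma off_diagonal_form_le (dotH : hilbert_dot dot)
    (T S D : {linear H -> H}) (s t : bool) x y :
  (forall u, A u = 0 -> A (D u) = 0) ->
  (forall u, S u = (-1) ^+ s *: T u + (-1) ^+ t *: D u) ->
  p x ^+ 2 + p y ^+ 2 = 1 ->
  ((complex.Re `|B (T y) x + B (S x) y|)%:E <=
     A_numerical_radius dot A T + A_opnorm dot A D * (2^-1)%:E)%E.
Proof.
move=> D_ker SE xy1; have hB := A_dot_semi_inner.
have half0 : (0 <= (2^-1 : R)%:E)%E by rewrite lee_fin invr_ge0.
have W0 : (0 <= A_numerical_radius dot A T)%E by apply: sup_ge0_ge0.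
have C0 : (0 <= A_opnorm dot A D)%E by apply: sup_ge0_ge0.
(* If either supremum is +oo, so is the right side, its other term being nonnegative. *)
case WE : (A_numerical_radius dot A T) W0 => [w| |] // w0; last first.
  by rewrite addye ?leey // gt_eqF // (lt_le_trans _ (mule_ge0 C0 half0)) // ltNy0.
case CE : (A_opnorm dot A D) C0 => [C| |] // C0; last first.
  by rewrite gt0_mulye ?lte_fin ?invr_gt0 // addey ?leey.
rewrite -EFinM -EFinD lee_fin; rewrite lee_fin in C0.
(* Since c^* = (-1)^s c, the unimodular c factors out of the polarized form and leaves only the sign
   (-1)^s. *)
have [c c1 cE] : exists2 c : R[i], `|c| = 1 & c^* = (-1) ^+ s * c.
  case: s SE => _; first by exists 'i; rewrite ?normCi ?conjCi ?expr1 ?mulN1r.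
  by exists 1; rewrite ?normr1 ?rmorph1 ?expr0 ?mulr1.
have TTE : `|B (T y) x + (-1) ^+ s * B (T x) y| <= w%:C.
  have := numerical_radius_polarization x y WE c1; rewrite xy1 mulr1 cE.
  by rewrite [_ * c]mulrC -mulrA -mulrDr normrM c1 mul1r.
have DE : `|B (D x) y| <= (C / 2)%:C.
  apply: le_trans (semi_inner_CauchySchwarz hB _ _) _; rewrite lecR.
  rewrite -[seminorm _ y]/(p y) -[seminorm _ _]/(p (D x)).
  apply: le_trans (ler_wpM2r (sqrtr_ge0 _) (le_A_opnorm dotH x D_ker CE)) _.
  (* The factor 1/2 comes from 2 p(x) p(y) <= p(x)^2 + p(y)^2 = 1. *)
  rewrite -mulrA ler_wpM2l //; have := sqr_ge0 (p x - p y).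
  by rewrite sqrrB -[Num.sqrt _]/(p y); lra.
suff : `|B (T y) x + B (S x) y| <= (w + C / 2)%:C by rewrite lecE => /andP[].
rewrite SE (semi_innerDl hB) !(semi_innerZl hB) addrA rmorphD.
apply: le_trans (ler_normD _ _) (lerD TTE _).
by rewrite normrM normrX normrN1 expr1n mul1r.
Qed.

End A_seminorm.

(** * The off-diagonal block operator *)

Lemma block_diag_A_dot (R : realType) (V : lmodType R[i])
    (dot : {dot V for Num.conj}) (A : V -> V) (u v : V * V) :
  A_dot (dsum_dot dot) (block_op A \0 \0 A) u v =
  A_dot dot A u.1 v.1 + A_dot dot A u.2 v.2.
Proof. by rewrite /A_dot /dsum_dot /block_op /= addr0 add0r. Qed.

Unset Implicit Arguments.

Theorem theorem3p1 (R : realType) (H : completeNormedModType R[i])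
    (dot : {dot H for Num.conj}) (dotH : hilbert_dot dot)
    (A : {linear H -> H}) (A_pos : positive_op dot A)
    (T2 T3 : {linear H -> H})
    (LT2 : has_A_adjoint dot A T2) (LT3 : has_A_adjoint dot A T3) :
  (A_numerical_radius (dsum_dot dot) (block_op A \0 \0 A)
     (block_op \0 T2 T3 \0)
   <= mine (A_numerical_radius dot A T2) (A_numerical_radius dot A T3)
      + mine (A_opnorm dot A (T2 \+ T3)%R * (2^-1)%:E)
             (A_opnorm dot A (T2 \- T3)%R * (2^-1)%:E))%E.
Proof.
have half0 : (0 <= (2^-1 : R)%:E)%E by rewrite lee_fin invr_ge0.
apply: sup_ge0_le => [|_ [[x y] xy1 <-]].
  by rewrite adde_ge0 // le_min ?mule_ge0 ?sup_ge0_ge0.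
have hB := A_dot_semi_inner A_pos.
have {}xy1 : A_norm dot A x ^+ 2 + A_norm dot A y ^+ 2 = 1.
  apply: complexI; rewrite rmorphD /= !(sqr_seminorm hB).
  rewrite -(expr1n _ 2) -xy1.
  rewrite sqr_sqrtr block_diag_A_dot /= -!(sqr_seminorm hB) -rmorphD //=.
  by rewrite addr_ge0 ?sqr_ge0.
have -> : A_dot (dsum_dot dot) (block_op A \0 \0 A)
    (block_op \0 T2 T3 \0 (x, y)) (x, y) =
    A_dot dot A (T2 y) x + A_dot dot A (T3 x) y.
  by rewrite block_diag_A_dot /= add0r addr0.
have K2 u : A u = 0 -> A (T2 u) = 0 := has_A_adjoint_ker A_pos LT2.
have K3 u : A u = 0 -> A (T3 u) = 0 := has_A_adjoint_ker A_pos LT3.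
pose Dp : {linear H -> H} := T2 \+ T3.
pose Dm : {linear H -> H} := T2 \- T3.
have Kp u : A u = 0 -> A (Dp u) = 0.
  by move=> u0; rewrite /= linearD K2 ?K3 ?addr0.
have Km u : A u = 0 -> A (Dm u) = 0.
  by move=> u0; rewrite /= linearB K2 ?K3 ?subr0.
have yx1 := xy1; rewrite addrC in yx1.
(* Each choice of the two minima has its own splitting: T3 = -T2 + Dp, T3 = T2 - Dm, T2 = -T3 + Dp
   and T2 = T3 + Dm. In the last two, x and y exchange roles. *)
rewrite /mine; case: ifP => _; case: ifP => _.
- apply: (off_diagonal_form_le A_pos dotH (D := Dp) (s := true) (t := false)) => // u.
  by rewrite expr0 expr1 scaleN1r scale1r /= addKr.
- apply: (off_diagonal_form_le A_pos dotH (D := Dm) (s := false) (t := true)) => // u.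
  by rewrite expr0 expr1 scaleN1r scale1r /= opprB addrC subrK.
- rewrite addrC.
  apply: (off_diagonal_form_le A_pos dotH (D := Dp) (s := true) (t := false)) => // u.
  by rewrite expr0 expr1 scaleN1r scale1r /= addrC addrK.
- rewrite addrC.
  apply: (off_diagonal_form_le A_pos dotH (D := Dm) (s := false) (t := false)) => // u.
  by rewrite expr0 !scale1r /= addrC subrK.
Qed.
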